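(* For $n\ge 1$, let $b_n(\lambda)$ be the characteristic polynomial of the $n\times n$ matrix $B_n$ whose $(p,q)$ entry is $2^{q-p-1}$ if $q>p$, $0$ if $q=p$, $1$ if $q=p-1$, and $0$ if $q<p-1$; and let $b_0(\lambda)=1$. Then for all $n\ge 1$, $$b_{n}(\lambda) = -\lambda b_{n-1}(\lambda)-\frac{1}{4}\sum_{i=2}^{n}(-2)^{i}b_{n-i}(\lambda).$$
   Context: The characteristic polynomial of an $n\times n$ matrix $B_n$ is $\det(B_n-\lambda I)$. Empty sums are $0$. *)

(* Defs.v *)
From HB Require Import structures.
From mathcomp Require Import all_boot all_order all_algebra.

Set Implicit Arguments.
Unset Strict Implicit.
Unset Printing Implicit Defensive.

Import Order.TTheory GRing.Theory Num.Theory.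
Local Open Scope ring_scope.

(* det (A - lambda I), with lambda the indeterminate 'X.  MathComp's
   [char_poly] is det (lambda I - A), which differs by the sign (-1)^n. *)
Definition charpoly (R : comNzRingType) (n : nat) (A : 'M[R]_n) : {poly R} :=
  \det (map_mx polyC A - 'X%:M).

(* Indices are 0-based; the entries depend only on the difference q - p. *)
Definition matB (R : comNzRingType) (n : nat) : 'M[R]_n :=
  \matrix_(p < n, q < n)
    if (p < q)%N then 2 ^+ (q - p - 1)%N
    else if (q.+1 == p)%N then 1
    else 0.

Definition polb (R : comNzRingType) (n : nat) : {poly R} :=
  if n is 0 then 1 else charpoly (matB R n).

(* Main.v *)
(* Expanding along the first column, where only the two top entries are nonzero,
   gives [b_(n+2) = - X b_(n+1) - d_(n+1)], where [d_m] is the determinant of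
   [B_m - X I] with its top row replaced by [(1, 2, 4, ...)].  Deleting the second
   row and the first column of the latter leaves twice the top row of the next
   smaller such matrix, so [d_(m+1) = b_m - 2 d_m], which unrolls into the sum. *)

Require Import Defs.
From HB Require Import structures.
From mathcomp Require Import all_boot all_order all_algebra.
From mathcomp Require Import ring.

Set Implicit Arguments.
Unset Strict Implicit.
Unset Printing Implicit Defensive.

Import Order.TTheory GRing.Theory Num.Theory.
Local Open Scope ring_scope.

Lemma det_col0_two (R : comNzRingType) (n : nat) (A : 'M[R]_n.+2) :
  (forall i : 'I_n, A (lift ord0 (lift ord0 i)) ord0 = 0) ->
  \det A = A ord0 ord0 * \det (row' ord0 (col' ord0 A))
    - A (lift ord0 ord0) ord0 * \det (row' (lift ord0 ord0) (col' ord0 A)).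
Proof.
move=> A0; rewrite (expand_det_col A ord0) big_ord_recl big_ord_recl.
rewrite big1 => [|i _]; last by rewrite A0 mul0r.
by rewrite /cofactor /= expr0 expr1 mul1r mulN1r mulrN addr0.
Qed.

Section TopRow.

Variable R : comNzRingType.

Definition charmxB (n : nat) : 'M[{poly R}]_n :=
  map_mx polyC (matB R n) - 'X%:M.

Definition charmxB_pow2 (n : nat) : 'M[{poly R}]_n :=
  \matrix_(p, q) if p == 0%N :> nat then 2 ^+ q else charmxB n p q.

Lemma charmxBE n p q : charmxB n p q =
  if (p < q)%N then 2 ^+ (q - p - 1)
  else if (q.+1 == p)%N then 1 else if p == q then - 'X else 0.
Proof.
rewrite !mxE -(inj_eq val_inj) /=.
case: ltngtP => [lt_pq|lt_qp|eq_pq].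
- by rewrite subr0 rmorphXn /= rmorph_nat.
- by rewrite subr0; case: eqP.
- by rewrite eq_pq (gtn_eqF (ltnSn _)) polyC0 sub0r.
Qed.

(** The convention $b_0 = 1$ agrees with the determinant of the empty matrix, so recurrences on
    determinants also cover size 0. *)
Lemma det_charmxB n : \det (charmxB n) = polb R n.
Proof. by case: n => [|n] //; rewrite det_mx00. Qed.

Lemma minor00_charmxB n : row' ord0 (col' ord0 (charmxB n.+1)) = charmxB n.
Proof.
by apply/matrixP=> i j; rewrite 2!mxE !charmxBE !lift0 (inj_eq lift_inj).
Qed.

(** The surviving top row is row 0 without its diagonal entry, that is 1, 2, 4, ...; below it, row
    and column indices both shift by one, which preserves $q - p$. *)
Lemma minor10_charmxB n :
  row' (lift ord0 ord0) (col' ord0 (charmxB n.+2)) = charmxB_pow2 n.+1.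
Proof.
apply/matrixP=> i j; rewrite 2!mxE [RHS]mxE.
case: (unliftP ord0 i) => [k|] ->.
  by rewrite !charmxBE -!(inj_eq val_inj).
by rewrite charmxBE /= subn1.
Qed.

Lemma minor00_charmxB_pow2 n :
  row' ord0 (col' ord0 (charmxB_pow2 n.+1)) = charmxB n.
Proof.
by rewrite -minor00_charmxB; apply/matrixP=> i j; rewrite 3!mxE [RHS]mxE [RHS]mxE.
Qed.

Lemma det_minor10_charmxB_pow2 n :
  \det (row' (lift ord0 ord0) (col' ord0 (charmxB_pow2 n.+2))) =
  2 * \det (charmxB_pow2 n.+1).
Proof.
set A := row' _ _.
(* Below row 0, both matrices have the entries of the same submatrix of [charmxB n.+2]. *)
have rowsE : row' ord0 (charmxB_pow2 n.+1) = row' ord0 A.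
  by rewrite -minor10_charmxB; apply/matrixP=> i j; rewrite !mxE.
(* Row 0 of [A] is $2^{j+1} = 2 \cdot 2^j$, so linearity in that row pulls out the 2. The slot with
   coefficient 0 is filled by [A], whose other rows match trivially. *)
rewrite (@determinant_multilinear _ _ A (charmxB_pow2 n.+1) A ord0 2 0) //.
  by rewrite mul0r addr0.
by apply/rowP=> j; rewrite !mxE /= mul0r addr0 exprS.
Qed.

Lemma polbSS n :
  polb R n.+2 = - 'X * polb R n.+1 - \det (charmxB_pow2 n.+1).
Proof.
rewrite -2!det_charmxB det_col0_two => [|i]; last by rewrite charmxBE.
by rewrite minor00_charmxB minor10_charmxB !charmxBE /= mul1r.
Qed.

Lemma det_charmxB_pow2SS n :
  \det (charmxB_pow2 n.+2) = polb R n.+1 - 2 * \det (charmxB_pow2 n.+1).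
Proof.
rewrite det_col0_two => [|i]; last by rewrite mxE /= charmxBE.
rewrite minor00_charmxB_pow2 det_minor10_charmxB_pow2 det_charmxB.
by rewrite mxE mul1r mxE /= charmxBE mul1r.
Qed.

Lemma det_charmxB_pow2 n : \det (charmxB_pow2 n.+1) =
  \sum_(0 <= i < n.+1) (- 2) ^+ i *: polb R (n - i).
Proof.
(* Base case: $d_1 = 1 = b_0$. In the step, the term $i = 0$ is the new $b_{n+1}$, and the factor
   $-2$ shifts the other terms by one. *)
elim: n => [|n IHn]; first by rewrite det_mx11 mxE big_nat1 scale1r.
rewrite det_charmxB_pow2SS IHn [RHS]big_nat_recl // scale1r subn0.
congr (_ + _); rewrite mulr_sumr -sumrN; apply: eq_bigr => i _.
by rewrite exprS -scalerA scaleNr scaler_nat mulr_natl.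
Qed.

End TopRow.

Theorem corollary7 (R : numFieldType) (n : nat) (hn : (1 <= n)%N) :
  polb R n =
    - 'X * polb R (n - 1)
    - (1 / 4 : R) *: \sum_(2 <= i < n.+1) (- 2) ^+ i *: polb R (n - i).
Proof.
case: n hn => [//|[|n]] _.
  (* For $n = 1$ the sum is empty and $b_0 = 1$; [polbSS] only starts at size 2. *)
  rewrite big_geq // scaler0 subr0 mulr1 -det_charmxB det_mx11.
  by rewrite charmxBE.
(* Reindexing the sum by $i + 2$ makes the indices of the two sums agree. *)
rewrite polbSS subn1 det_charmxB_pow2 (big_addn 0 _ 2) subSS subSS subn0.
congr (_ - _); rewrite scaler_sumr; apply: eq_bigr => i _.
rewrite scalerA addn2 !subSS; congr (_ *: _).
(* The shift contributes $(-2)^2 = 4$, which cancels the factor $1/4$. *)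
by rewrite !exprS; field.
Qed.
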